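(* Let $(\vec x,\vec y)$ be a totally positive specialization, written as $x_k=c_k(1+t_{k-1})$, $y_k=c_kc_{k+1}t_k$ for $k\ge1$ with $t_0=0$ and positive real sequences $\vec c,\vec t$. Then for every $n\ge1$ the associated $n$-th Stieltjes moment is $$a_n=\sum_{\varkappa\in\mathrm{Comp}(n)}N(\varkappa)\;\boldsymbol c^{\,\mathrm A(\varkappa)}\;\boldsymbol t^{\,\mathrm{dep}(\mathrm B(\varkappa))},\qquad N(\varkappa)=\#\{\pi\in\mathrm{NC}(n):\boldsymbol z(\pi)=\varkappa\},$$ where the sum is over all compositions $\varkappa$ of $n$.
   Context: Totally positive specialization: the semi-infinite tridiagonal matrix with diagonal $x_1,x_2,\ldots$, superdiagonal $y_1,y_2,\ldots$, subdiagonal entries $1$ has all its not identically vanishing minors positive; this is equivalent to the existence of (unique) positive real sequences $\vec c=(c_1,c_2,\ldots)$, $\vec t=(t_1,t_2,\ldots)$ such that $x_k=c_k(1+t_{k-1})$ and $y_k=c_kc_{k+1}t_k$ for all $k\ge1$, with the convention $t_0=0$. Moments (with $a_0=1$): coefficients of the Jacobi continued fraction $\sum_{n\ge0}a_nz^n=1/(1-x_1z-y_1z^2/(1-x_2z-y_2z^2/(1-x_3z-\cdots)))$; equivalently $a_n$ is the sum over Motzkin paths of length $n$ of the product of step weights: up step from height $k-1$ to $k$ has weight $y_k$, horizontal step at height $k$ has weight $x_{k+1}$, down steps have weight $1$. A composition of $n$ is a sequence of positive integers summing to $n$. For a composition $\alpha=(\alpha_1,\ldots,\alpha_p)$, $\boldsymbol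 c^{\alpha}=c_1^{\alpha_1}\cdots c_p^{\alpha_p}$ and $\boldsymbol t^\alpha=t_1^{\alpha_1}\cdots t_p^{\alpha_p}$ (equal to $1$ for the empty composition). Splitting: for $\varkappa=(\varkappa_1,\ldots,\varkappa_m)\in\mathrm{Comp}(n)$ and $p=\lfloor m/2\rfloor$, define compositions $\mathrm A(\varkappa)=(\alpha_1,\ldots,\alpha_{p+1})$, $\mathrm B(\varkappa)=(\beta_1,\ldots,\beta_{p+1})$ of $n$. If $m=1$, $\mathrm A(\varkappa)=\mathrm B(\varkappa)=\varkappa$. If $m\ge2$: $\alpha_1=\varkappa_1$, $\alpha_k=\varkappa_{2k-2}+\varkappa_{2k-1}$ for $2\le k\le p$, and $\alpha_{p+1}=\varkappa_{2p}$ if $m=2p$, $\alpha_{p+1}=\varkappa_{2p}+\varkappa_{2p+1}$ if $m=2p+1$; $\beta_1=1-p+\sum_{j\text{ odd},\,j\le m}\varkappa_j$, $\beta_k=1+\varkappa_{2k-2}$ for $2\le k\le p$, $\beta_{p+1}=\varkappa_{2p}$. Depletion: for $\varsigma=(\varsigma_1,\ldots,\varsigma_p)$ with $p\ge2$, $\mathrm{dep}(\varsigma)=(\delta_1,\ldots,\delta_{p-1})$ with $\delta_k=\varsigma_{k+1}-1$ for $1\le k\le p-2$ and $\delta_{p-1}=\varsigma_p$; for $p=1$ it is the empty composition. Set partition statistics: for a set partition $\pi$ of $\{1,\ldots,n\}$, $a$ precedes $b$ (and $b$ succeeds $a$) if they are consecutive elements of the same block listed increasingly. $\pi$ is non-crossing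 ($\pi\in\mathrm{NC}(n)$) if there are no $a<c<b<d$ with $a$ preceding $b$ and $c$ preceding $d$. An element is a singleton if its block has size one; an opener (resp. closer) if it is the minimum (resp. maximum) of a non-singleton block; a transient otherwise. $\Gamma_i(\pi)$ is the set of openers or transients $a<i$ such that $i\le b$, where $b$ succeeds $a$. For $i$ a closer or transient, $\gamma_i(\pi)$ is the position of the element preceding $i$ in the increasing list of $\Gamma_i(\pi)$. $\ell_k(\pi)=\#\{i:\#\Gamma_i(\pi)=k\}$ ($k\ge0$); $g_k(\pi)$ is the number of closers or transients $i$ with $\gamma_i(\pi)=k$ ($k\ge1$). With $p=\max\{k:\ell_k(\pi)>0\}$, put $z_1=\ell_0(\pi)$, $z_{2k}=g_k(\pi)$, $z_{2k+1}=\ell_k(\pi)-g_k(\pi)$ for $1\le k\le p$. For $p\ge1$, $\boldsymbol z(\pi)=(z_1,\ldots,z_{2p+1})$ if $\ell_p(\pi)>g_p(\pi)$ and $\boldsymbol z(\pi)=(z_1,\ldots,z_{2p})$ if $\ell_p(\pi)=g_p(\pi)$; for $p=0$, $\boldsymbol z(\pi)=(n)$. It is a composition of $n$ for $\pi\in\mathrm{NC}(n)$. *)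

(* Defs.v *)
From mathcomp Require Import all_boot all_order all_algebra.
From mathcomp Require Import reals.

Set Implicit Arguments.
Unset Strict Implicit.
Unset Printing Implicit Defensive.

Import Order.TTheory GRing.Theory Num.Theory.

(* All sequences and tuples of the paper are indexed from 1: a sequence is a
   function on nat whose value at 0 plays no role (except for [t 0 = 0]), and
   [part s j] is the j-th entry of a tuple s. *)
Definition part (s : seq nat) (j : nat) : nat := nth 0 s j.-1.

Definition is_composition (n : nat) (s : seq nat) : bool :=
  all (leq 1) s && (sumn s == n).

(* A composition of n has at most n parts, each at most n; see
   [mem_compositions] and [compositions_uniq]. *)
Definition compositions (n : nat) : seq (seq nat) :=
  [seq s <- [seq [seq val i | i <- w] | w : n.-bseq 'I_n.+1] | is_composition n s].

Lemma compositions_uniq n : uniq (compositions n).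
Proof.
rewrite filter_uniq // map_inj_uniq ?enum_uniq // => u v.
by move/(inj_map val_inj) => uv; apply: val_inj.
Qed.

Lemma mem_compositions n s : (s \in compositions n) = is_composition n s.
Proof.
rewrite mem_filter andb_idr // => /andP[/allP s_gt0 /eqP sn].
have s_le : size s <= n.
  rewrite -sn; elim: s s_gt0 {sn} => //= x s IHs s_gt0.
  rewrite -add1n leq_add ?s_gt0 ?mem_head // IHs // => y ys.
  by rewrite s_gt0 // inE ys orbT.
have le_n x : x \in s -> x < n.+1.
  rewrite ltnS -sn; elim: s {s_gt0 sn s_le} => //= y s IHs.
  by rewrite inE => /orP[/eqP->|/IHs xs]; rewrite ?leq_addr ?(leq_trans xs) ?leq_addl.
have size_w : size [seq inord x : 'I_n.+1 | x <- s] <= n by rewrite size_map.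
apply/mapP; exists (Bseq size_w); first by rewrite mem_enum.
rewrite /= -map_comp -[LHS]map_id; apply/eq_in_map => x xs /=.
by rewrite inordK ?le_n.
Qed.

Section Splitting.
Variable k : seq nat.
Let m := size k.
Let p := m./2.

Definition splitA : seq nat :=
  if m <= 1 then k else
  part k 1 :: rcons [seq part k (2 * i - 2) + part k (2 * i - 1) | i <- iota 2 p.-1]
    (if odd m then part k (2 * p) + part k (2 * p + 1) else part k (2 * p)).

(* The subtraction of p is not truncated when k is a composition: at least p
   odd indices j occur in the sum. *)
Definition splitB : seq nat :=
  if m <= 1 then k else
  1 + \sum_(1 <= j < m.+1 | odd j) part k j - p
    :: rcons [seq 1 + part k (2 * i - 2) | i <- iota 2 p.-1] (part k (2 * p)).

End Splitting.

Definition dep (s : seq nat) : seq nat :=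
  let p := size s in
  if p <= 1 then [::] else
  rcons [seq part s i.+1 - 1 | i <- iota 1 (p - 2)] (part s p).

(* The ground set {1, ..., n} is represented by the ordered set 'I_n: only the
   order of the elements matters below. P is meant to be a partition of setT,
   so that [pblock P i] is the block of i. *)
Section SetPartition.
Variables (n : nat) (P : {set {set 'I_n}}).

Definition precedes (a b : 'I_n) : bool :=
  [&& a < b, b \in pblock P a & [forall c in pblock P a, ~~ (a < c < b)]].

Definition noncrossing : bool :=
  partition P [set: 'I_n] &&
  [forall a : 'I_n, forall b : 'I_n, forall c : 'I_n, forall d : 'I_n,
    ~~ [&& a < c, c < b, b < d, precedes a b & precedes c d]].

Definition singleton (i : 'I_n) : bool := #|pblock P i| == 1.
Definition opener (i : 'I_n) : bool :=
  ~~ singleton i && [forall j in pblock P i, i <= j].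
Definition closer (i : 'I_n) : bool :=
  ~~ singleton i && [forall j in pblock P i, j <= i].
Definition transient (i : 'I_n) : bool :=
  [&& ~~ singleton i, ~~ opener i & ~~ closer i].

Definition Gam (i : 'I_n) : {set 'I_n} :=
  [set a | [&& opener a || transient a, a < i
             & [exists b, precedes a b && (i <= b)]]].

(* [enum] lists a subset of 'I_n increasingly; [index] counts from 0. *)
Definition gam (i : 'I_n) : nat :=
  if [pick a | precedes a i] is Some a then (index a (enum (Gam i))).+1 else 0.

Definition ell (k : nat) : nat := #|[set i | #|Gam i| == k]|.
Definition gnum (k : nat) : nat :=
  #|[set i | (closer i || transient i) && (gam i == k)]|.

Definition ell_max : nat := \max_(k < n.+1 | 0 < ell k) k.

(* In the odd case the subtraction is not truncated for non-crossing P, where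
   gam i = #|Gam i| for every closer or transient i. *)
Definition zstat (j : nat) : nat :=
  if j == 1 then ell 0
  else if odd j then ell j./2 - gnum j./2 else gnum j./2.

Definition zcomp : seq nat :=
  let p := ell_max in
  if p == 0 then [:: n]
  else [seq zstat j | j <- iota 1 (if gnum p < ell p then 2 * p + 1 else 2 * p)].

End SetPartition.

Definition NC (n : nat) : {set {set {set 'I_n}}} := [set P | noncrossing P].

Definition Ncount (n : nat) (k : seq nat) : nat :=
  #|[set P in NC n | zcomp P == k]|.

Local Open Scope ring_scope.

Definition monom (R : realType) (c : nat -> R) (s : seq nat) : R :=
  \prod_(1 <= j < (size s).+1) c j ^+ part s j.

Section TotallyPositive.
Variable R : realType.
Implicit Types x y : nat -> R.

(* Rows and columns are indexed from 1. *)
Definition tridiag x y (i j : nat) : R :=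
  if j == i then x i
  else if j == i.+1 then y i
  else if i == j.+1 then 1
  else 0.

Definition minor x y (d : nat) (r s : 'I_d -> nat) : R :=
  \det (\matrix_(i < d, j < d) tridiag x y (r i) (s j)).

Definition index_choice (d : nat) (r : 'I_d -> nat) : Prop :=
  (forall i, (0 < r i)%N) /\ {homo r : i j / (i < j)%N}.

Definition vanishes_identically (d : nat) (r s : 'I_d -> nat) : Prop :=
  forall x y, minor x y r s = 0.

Definition totally_positive x y : Prop :=
  forall (d : nat) (r s : 'I_d -> nat), index_choice r -> index_choice s ->
    ~ vanishes_identically r s -> 0 < minor x y r s.

End TotallyPositive.

(* A formal power series is the sequence of its coefficients, from degree 0. *)
Section JacobiFraction.
Variable R : realType.
Implicit Types f g : nat -> R.

Definition fps_mul f g : nat -> R :=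
  fun n => \sum_(i < n.+1) f i * g (n - i)%N.

Definition fps_one : nat -> R := fun n => (n == 0)%:R.

(* 1 - u z - v z^2 f(z) *)
Definition jden (u v : R) f : nat -> R :=
  fun n => match n with 0 => 1 | 1 => - u | n'.+2 => - (v * f n') end.

(* a is the expansion of the continued fraction
     1 / (1 - x_1 z - y_1 z^2 / (1 - x_2 z - y_2 z^2 / (1 - x_3 z - ...)))
   F k being the expansion of its k-th tail
     1 / (1 - x_k z - y_k z^2 / (1 - x_{k+1} z - ...)).
   Such an a exists and is unique: see [moments_exist] and [moments_unique]. *)
Definition moments (x y a : nat -> R) : Prop :=
  exists F : nat -> nat -> R,
    F 1 =1 a /\
    forall k, (1 <= k)%N ->
      fps_mul (F k) (jden (x k) (y k) (F k.+1)) =1 fps_one.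

Lemma fps_mul_jdenE u v f g :
  fps_mul f (jden u v g) =1 fps_one <->
  [/\ f 0 = 1, f 1 = u & forall n,
      f n.+2 = u * f n.+1 + v * \sum_(i < n.+1) f i * g (n - i)%N].
Proof.
have E0 : fps_mul f (jden u v g) 0 = f 0.
  by rewrite /fps_mul big_ord1 mulr1.
have E1 : fps_mul f (jden u v g) 1 = f 1 - u * f 0.
  by rewrite /fps_mul !big_ord_recr big_ord0 /= add0r mulr1 mulrN addrC [f 0 * u]mulrC.
have E2 n : fps_mul f (jden u v g) n.+2 =
    f n.+2 - (u * f n.+1 + v * \sum_(i < n.+1) f i * g (n - i)%N).
  rewrite /fps_mul 2!big_ord_recr /= subnn subSnn /= mulr1 mulrN [f _ * u]mulrC.
  rewrite addrC opprD; congr (_ + _); rewrite addrC; congr (_ + _).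
  rewrite mulr_sumr -sumrN; apply: eq_bigr => i _.
  have lein : (i <= n)%N by rewrite -ltnS.
  by rewrite 2?subSn ?(leqW lein) //= mulrN mulrCA.
split=> [H|[f0 f1 f2] [|[|n]]].
- have f0 : f 0 = 1 by rewrite -E0 H.
  split=> // [|n]; apply/eqP; rewrite -subr_eq0.
    by rewrite -{1}[u]mulr1 -{1}f0 -E1 H.
  by rewrite -E2 H.
- by rewrite E0 f0.
- by rewrite E1 f0 f1 mulr1 subrr.
- by rewrite E2 f2 subrr.
Qed.

Lemma moments_unique x y a b : moments x y a -> moments x y b -> a =1 b.
Proof.
move=> [F [Fa HF]] [G [Gb HG]] m; rewrite -Fa -Gb.
have [k k1] : {k | 1 <= k & k = 1}%N by exists 1%N.
suff H : forall N m k, (1 <= k)%N -> (m < N)%N -> F k m = G k m by move=> _; apply: (H m.+1).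
elim=> // N IH {}m {k1}k k1.
have /fps_mul_jdenE [F0 F1 F2] := HF k k1.
have /fps_mul_jdenE [G0 G1 G2] := HG k k1.
case: m => [|[|m]]; rewrite ?F0 ?F1 ?G0 ?G1 // ltnS => mN.
rewrite F2 G2 IH //; congr (_ + _ * _); apply: eq_bigr => i _.
have iN : (i < N)%N by apply: leq_trans mN; rewrite ltnW // ltnS.
have jN : (m - i < N)%N by apply: leq_trans mN; rewrite ltnW // ltnS ltnS leq_subr.
by rewrite (IH i) // (IH (m - i)%N).
Qed.

Lemma moments_exist x y : exists a, moments x y a.
Proof.
pose fix J N k m {struct N} : R := if N is N'.+1 then
  match m with
  | 0 => 1 | 1 => x k
  | m'.+2 =>
    x k * J N' k m'.+1 + y k * \sum_(i < m'.+1) J N' k i * J N' k.+1 (m' - i)%N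
  end else 0.
have J_stable N N' k m : (m < N)%N -> (m < N')%N -> J N k m = J N' k m.
  elim: N N' k m => // N IH [//|N'] k [|[|m]] //; rewrite !ltnS => mN mN' /=.
  rewrite (IH N') //; congr (_ + _ * _); apply: eq_bigr => i _.
  have iN : (i < m.+1)%N by [].
  have jN : (m - i < m.+1)%N by rewrite ltnS leq_subr.
  by rewrite !(IH N') // (leq_trans _ mN, leq_trans _ mN') // ltnW.
exists (fun m => J m.+1 1 m), (fun k m => J m.+1 k m); split=> // k _.
apply/fps_mul_jdenE; split=> // m; rewrite [LHS]/=.
congr (_ + _ * _); apply: eq_bigr => i _.
have im : (i < m.+2)%N by rewrite ltnW // ltnS.
have jm : (m - i < m.+2)%N by rewrite ltnW // ltnS ltnS leq_subr.
rewrite (J_stable i.+1 m.+2 k i) // (J_stable (m - i).+1%N m.+2 k.+1) //.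
Qed.

End JacobiFraction.

(* Main.v *)
Require Import Defs.
From mathcomp Require Import all_boot all_order all_algebra.
From mathcomp Require Import reals.
From mathcomp Require Import zify ring.

(* Element [i] of a partition [P] is recorded by two bits: whether it has a
   predecessor and whether it has a successor in its block. For non-crossing [P]
   this word is a two-coloured Motzkin path whose height before step [i] is
   [#|Gam P i|], and [P] can be read off the path (its blocks are the sets of
   steps of equal level not separated by a descent below that level), so NC(n)
   is in bijection with these paths. Non-crossing also forces
   [gam P i = #|Gam P i|], so the monomial of [zcomp P] factors as the product
   over [i] of [c_(h+1)], times [t_h] if [i] has a predecessor, where
   [h = #|Gam P i|]. Splitting the horizontal weight [x_(h+1)] as
   [c_(h+1) + c_(h+1) t_h] and [y_(h+1)] as [c_(h+1)] (up) times
   [c_(h+2) t_(h+1)] (down) gives the moments of the continued fraction. *)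

Set Implicit Arguments.
Unset Strict Implicit.
Unset Printing Implicit Defensive.

Import Order.TTheory GRing.Theory Num.Theory.

(** * Arcs of a set partition *)

Definition has_pred n (P : {set {set 'I_n}}) (i : 'I_n) : bool :=
  [exists a, precedes P a i].
Definition has_succ n (P : {set {set 'I_n}}) (i : 'I_n) : bool :=
  [exists b, precedes P i b].

(** Extends [Gam] to every boundary [m] between [0] and [n], so that the set of open arcs just after
    a step, and after the last one, is also available. *)
Definition arcs n (P : {set {set 'I_n}}) (m : nat) : {set 'I_n} :=
  [set a : 'I_n | (a < m) && [exists b : 'I_n, precedes P a b && (m <= b)]].

Section Partition.
Variables (n : nat) (P : {set {set 'I_n}}).
Hypothesis partP : partition P [set: 'I_n].
Implicit Types i j a b : 'I_n.

Lemma mem_block i : i \in pblock P i.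
Proof. by rewrite mem_pblock (cover_partition partP) inE. Qed.

Lemma eq_block i j : (j \in pblock P i) = (pblock P i == pblock P j).
Proof.
have [_ tI _] := and3P partP.
by rewrite eq_pblock ?(cover_partition partP) ?inE.
Qed.

Lemma block_sym i j : (j \in pblock P i) = (i \in pblock P j).
Proof. by rewrite !eq_block eq_sym. Qed.

Lemma block_trans i j k :
  j \in pblock P i -> k \in pblock P j -> k \in pblock P i.
Proof. by rewrite !eq_block => /eqP->. Qed.

Lemma precedes_lt a b : precedes P a b -> a < b.
Proof. by case/and3P. Qed.

Lemma precedes_block a b : precedes P a b -> b \in pblock P a.
Proof. by case/and3P. Qed.

Lemma precedes_between a b c :
  precedes P a b -> c \in pblock P a -> a < c < b -> False.
Proof. by case/and3P=> _ _ /forall_inP H /H /negP. Qed.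

Lemma precedes_inj a a' b : precedes P a b -> precedes P a' b -> a = a'.
Proof.
move=> H H'; have [lt lt'] := (precedes_lt H, precedes_lt H').
have aa' : a' \in pblock P a.
  by apply: (block_trans (precedes_block H)); rewrite block_sym precedes_block.
have [l|l|/val_inj//] := ltngtP a a'.
  by case: (precedes_between H aa'); rewrite l lt'.
by case: (@precedes_between a' b a H'); rewrite ?l ?lt // block_sym.
Qed.

Lemma precedes_fun a b b' : precedes P a b -> precedes P a b' -> b = b'.
Proof.
move=> H H'; have [lt lt'] := (precedes_lt H, precedes_lt H').
have [l|l|/val_inj//] := ltngtP b b'.
  by case: (precedes_between H' (precedes_block H)); rewrite lt l.
by case: (precedes_between H (precedes_block H')); rewrite lt' l.
Qed.

Lemma exists_pred i j :
  j \in pblock P i -> j < i -> exists2 a, precedes P a i & j <= a.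
Proof.
move=> ji lt_ji.
have Pj : (j \in pblock P i) && (j < i) by rewrite ji.
have [a /andP[ai lt_ai] amax] := @arg_maxnP _ j (fun k => (k \in pblock P i) && (k < i)) val Pj.
exists a; last exact: amax.
rewrite /precedes lt_ai -block_sym ai; apply/forall_inP => c ca.
apply/negP => /andP[ac ci]; have := amax c; rewrite ci (block_trans ai) //= => /(_ isT).
by rewrite leqNgt ac.
Qed.

Lemma exists_succ i j :
  j \in pblock P i -> i < j -> exists2 b, precedes P i b & b <= j.
Proof.
move=> ji lt_ij.
have Pj : (j \in pblock P i) && (i < j) by rewrite ji.
have [b /andP[bi lt_ib] bmin] := @arg_minnP _ j (fun k => (k \in pblock P i) && (i < k)) val Pj.
exists b; last exact: bmin.
rewrite /precedes lt_ib bi; apply/forall_inP => c ca.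
apply/negP => /andP[ac ci]; have := bmin c; rewrite ca ac => /(_ isT).
by rewrite leqNgt ci.
Qed.

Lemma has_predE i : has_pred P i = [exists j in pblock P i, j < i].
Proof.
apply/existsP/exists_inP => [[a H]|[j ji lt_ji]].
  by exists a; rewrite ?(precedes_lt H) // block_sym precedes_block.
by have [a H _] := exists_pred ji lt_ji; exists a.
Qed.

Lemma has_succE i : has_succ P i = [exists j in pblock P i, i < j].
Proof.
apply/existsP/exists_inP => [[a H]|[j ji lt_ji]].
  by exists a; rewrite ?(precedes_lt H) // precedes_block.
by have [a H _] := exists_succ ji lt_ji; exists a.
Qed.

Lemma openerNE i : ~~ [forall j in pblock P i, i <= j] = has_pred P i.
Proof.
by rewrite has_predE negb_forall_in; apply: eq_existsb => j; rewrite -ltnNge.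
Qed.

Lemma closerNE i : ~~ [forall j in pblock P i, j <= i] = has_succ P i.
Proof.
by rewrite has_succE negb_forall_in; apply: eq_existsb => j; rewrite -ltnNge.
Qed.

Lemma singletonE i : singleton P i = ~~ (has_pred P i || has_succ P i).
Proof.
rewrite has_predE has_succE; apply/eqP/norP => [/eqP/cards1P[x Ex]|].
  have: i \in pblock P i := mem_block i.
  rewrite Ex inE => /eqP <-; split; apply/exists_inP => -[j];
    by rewrite inE => /eqP->; rewrite ltnn.
case=> /exists_inPn H1 /exists_inPn H2.
rewrite (_ : pblock P i = [set i]) ?cards1 //.
apply/setP => j; rewrite inE; apply/idP/eqP => [ji|->]; last exact: mem_block.
by apply/val_inj/eqP; rewrite eqn_leq leqNgt H2 //= leqNgt H1.
Qed.

Lemma openerE i : opener P i = ~~ has_pred P i && has_succ P i.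
Proof.
rewrite /opener singletonE -[X in _ && X]negbK openerNE.
by case: has_pred; case: has_succ.
Qed.

Lemma closerE i : closer P i = has_pred P i && ~~ has_succ P i.
Proof.
rewrite /closer singletonE -[X in _ && X]negbK closerNE.
by case: has_pred; case: has_succ.
Qed.

Lemma transientE i : transient P i = has_pred P i && has_succ P i.
Proof.
rewrite /transient singletonE openerE closerE.
by case: has_pred; case: has_succ.
Qed.

Lemma closer_transientE i : closer P i || transient P i = has_pred P i.
Proof. by rewrite closerE transientE; case: has_pred; case: has_succ. Qed.

Lemma GamE i : Gam P i = arcs P i.
Proof.
apply/setP => a; rewrite !inE openerE transientE.
rewrite -andb_orl orNb andTb andbCA; congr andb.
apply: andb_idl => /existsP[b /andP[ab _]].
by apply/existsP; exists b.
Qed.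

Lemma arcs0 : arcs P 0 = set0.
Proof. by apply/setP => a; rewrite !inE. Qed.

Lemma arcs_top : arcs P n = set0.
Proof.
apply/setP => a; rewrite !inE; apply/andP => -[_ /existsP[b /andP[_]]].
by rewrite leqNgt ltn_ord.
Qed.

(** Passing step [i] closes the arc ending at [i] and opens the one starting there; the arcs in [A]
    stay open. The additive form avoids truncated subtraction. *)
Lemma card_arcsS i :
  #|arcs P i.+1| + has_pred P i = #|arcs P i| + has_succ P i.
Proof.
pose A := arcs P i :&: arcs P i.+1.
have c1 : #|[set a | precedes P a i]| = has_pred P i.
  case: (boolP (has_pred P i)) => [/existsP[a ai]|/existsPn H].
    rewrite (_ : [set _ | _] = [set a]) ?cards1 //; apply/setP => a'.
    by rewrite !inE; apply/idP/eqP => [/precedes_inj/(_ ai)|->].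
  by apply/eqP; rewrite cards_eq0; apply/eqP/setP => a; rewrite !inE; apply/negbTE.
have c2 : #|[set a | (a == i) && has_succ P i]| = has_succ P i.
  case: (has_succ P i); last by apply/eqP; rewrite cards_eq0; apply/eqP/setP => a; rewrite !inE andbF.
  by apply: etrans (cards1 i); apply: eq_card => a; rewrite !inE andbT.
have E1 : arcs P i = A :|: [set a | precedes P a i].
  apply/setP => a; rewrite !inE; apply/idP/idP.
    move=> /andP[ai /existsP[b /andP[ab ib]]].
    move: ib; rewrite leq_eqVlt => /orP[/eqP/val_inj ->|ib]; first by rewrite ab orbT.
    apply/orP; left; apply/andP; split.
      by rewrite ai; apply/existsP; exists b; rewrite ab ltnW.
    by rewrite ltnW //; apply/existsP; exists b; rewrite ab ib.
  case/orP => [/andP[]//|ai].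
  by rewrite (precedes_lt ai); apply/existsP; exists i; rewrite ai /=.
have E2 : arcs P i.+1 = A :|: [set a | (a == i) && has_succ P i].
  apply/setP => a; rewrite !inE; apply/idP/idP.
    move=> /andP[ai /existsP[b /andP[ab ib]]].
    have /orP[/eqP/val_inj E|lt_ai] : (a == i :> nat) || (a < i) by rewrite -leq_eqVlt.
      apply/orP; right; rewrite E eqxx; apply/existsP; exists b; by rewrite -E.
    apply/orP; left; apply/andP; split.
      by rewrite lt_ai; apply/existsP; exists b; rewrite ab ltnW.
    by rewrite ai; apply/existsP; exists b; rewrite ab ib.
  case/orP => [/andP[]//|/andP[/eqP-> /existsP[b ib]]].
  by rewrite leqnn; apply/existsP; exists b; rewrite ib precedes_lt.
have d1 : A :&: [set a | precedes P a i] = set0.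
  apply/setP => a; rewrite !inE; apply/negbTE/negP.
  case/andP => /andP[_ /andP[_ /existsP[b /andP[ab ib]]]] ai.
  by move: ib; rewrite (precedes_fun ab ai) ltnn.
have d2 : A :&: [set a | (a == i) && has_succ P i] = set0.
  apply/setP => a; rewrite !inE; apply/negbTE/negP.
  by case/andP => /andP[/andP[ai _] _] /andP[/eqP E _]; move: ai; rewrite E ltnn.
by rewrite [in RHS]E1 E2 !cardsU c1 c2 d1 d2 cards0 !subn0 addnAC.
Qed.

Lemma has_pred_arcs i : has_pred P i -> 0 < #|arcs P i|.
Proof.
move=> /existsP[a ai]; rewrite card_gt0; apply/set0Pn; exists a.
by rewrite inE (precedes_lt ai); apply/existsP; exists i; rewrite ai /=.
Qed.

Lemma has_succ_arcs i : has_succ P i -> i \in arcs P i.+1.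
Proof.
move=> /existsP[b ib]; rewrite inE leqnn; apply/existsP; exists b.
by rewrite ib precedes_lt.
Qed.

Lemma mem_arcsP a m :
  reflect (a < m /\ exists2 b, precedes P a b & m <= b) (a \in arcs P m).
Proof.
rewrite inE; apply: (iffP andP) => -[am].
  by move=> /existsP[b /andP[]]; split=> //; exists b.
by move=> [b ab mb]; split=> //; apply/existsP; exists b; rewrite ab.
Qed.

Hypothesis ncP : noncrossing P.

Lemma noncrossingP a b c d :
  precedes P a b -> precedes P c d -> a < c -> c < b -> b < d -> False.
Proof.
move=> ab cd ac cb bd; have /andP[_ /'forall_'forall_'forall_'forall_negP] := ncP.
by move=> /(_ a b c d); rewrite ac cb bd ab cd.
Qed.

(** An arc open at [b] that starts after [a] either crosses the arc from [a] to [b] or ends at [b],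
    which would give [b] two predecessors. *)
Lemma arcs_le a b c : precedes P a b -> c \in arcs P b -> c <= a.
Proof.
move=> ab /mem_arcsP[cb [d cd bd]]; rewrite leqNgt; apply/negP => ac.
have [bd'|E] : b < d \/ b = d.
- by move: bd; rewrite leq_eqVlt => /orP[/eqP/val_inj|]; [right|left].
- exact: noncrossingP ab cd ac cb bd'.
by move: ac; rewrite (@precedes_inj c a b) ?ltnn // E.
Qed.

Lemma arcs_sub a b m : precedes P a b -> a < m <= b -> arcs P b \subset arcs P m.
Proof.
move=> ab /andP[am mb]; apply/subsetP => c cb.
have ca := arcs_le ab cb.
have /mem_arcsP[_ [d cd bd]] := cb.
apply/mem_arcsP; split; first by rewrite (leq_ltn_trans ca).
by exists d => //; rewrite (leq_trans mb).
Qed.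

(** For the inclusion not given by [arcs_sub]: an arc open just after [a] and closing before [b]
    cannot start at [a], whose successor is [b], and would cross the arc from [a] to [b] if it
    started earlier. *)
Lemma arcs_pred a b : precedes P a b -> arcs P a.+1 = arcs P b.
Proof.
move=> ab; apply/eqP; rewrite eqEsubset (@arcs_sub a b a.+1) ?precedes_lt ?leqnn //.
rewrite andbT; apply/subsetP => c /mem_arcsP[]; rewrite ltnS => ca [d cd ad].
apply/mem_arcsP; split; first by rewrite (leq_ltn_trans ca) ?precedes_lt.
exists d => //; rewrite leqNgt; apply/negP => db.
move: ca; rewrite leq_eqVlt => /orP[/eqP/val_inj E|ca].
  by move: db; rewrite -(@precedes_fun a b d) ?ltnn // -E.
exact: noncrossingP cd ab ca ad db.
Qed.

(** By [arcs_le] the predecessor of [i] is the largest element of [Gam P i], so its position in the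
    increasing list is the length of that list. *)
Lemma gamE i : gam P i = if has_pred P i then #|arcs P i| else 0.
Proof.
rewrite /gam /has_pred; case: pickP => [a ai|H]; last first.
  by case: existsP => // -[a]; rewrite H.
have -> : [exists a, precedes P a i] by apply/existsP; exists a.
rewrite GamE.
have ain : a \in enum (arcs P i).
  by rewrite mem_enum; apply/mem_arcsP; split; [exact: precedes_lt | exists i].
rewrite cardE; apply/eqP; rewrite eqn_leq index_mem ain /= leqNgt.
(* If [a] were not last, the next entry of the list would exceed [a], against [arcs_le]. *)
apply/negP => lt_s.
have sorted_enum : sorted (fun x y : 'I_n => x < y) (enum (arcs P i)).
  rewrite /enum_mem -enumT; apply: sorted_filter; first by move=> ? ? ?; exact: ltn_trans.
  have := iota_ltn_sorted 0 n; rewrite -val_enum_ord sorted_map /=; exact.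
have ltT : transitive (fun x y : 'I_n => x < y) by move=> ? ? ?; exact: ltn_trans.
have := sorted_ltn_nth ltT a sorted_enum.
move=> /(_ (index a (enum (arcs P i))) (index a (enum (arcs P i))).+1).
rewrite !inE ltnW // lt_s nth_index // ltnSn => /(_ isT isT isT).
rewrite ltnNge => /negP; apply; apply: arcs_le ai _.
by rewrite -mem_enum mem_nth.
Qed.

End Partition.

(** * Non-crossing partitions and Motzkin paths *)

(** The bits are (has a predecessor, has a successor). Adding first, truncation occurs only for
    [(true, false)] at height 0, which [balanced] excludes. *)
Definition step (h : nat) (l : bool * bool) : nat := h + l.2 - l.1.
Definition height (w : seq (bool * bool)) (m : nat) : nat :=
  foldl step 0 (take m w).

(** The second conjunct keeps the path nonnegative and also forbids the horizontal letter
    [(true, true)] at height 0, in accordance with [t 0 = 0]. *)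
Definition balanced n (w : n.-tuple (bool * bool)) : bool :=
  (height w n == 0) && [forall i, (tnth w i).1 ==> (0 < height w i)].

Lemma heightS n (w : n.-tuple (bool * bool)) (i : 'I_n) :
  height w i.+1 = step (height w i) (tnth w i).
Proof.
rewrite /height (take_nth (tnth w i)) ?size_tuple // -cats1 foldl_cat /=.
by rewrite -tnth_nth.
Qed.

Definition word_of n (P : {set {set 'I_n}}) : n.-tuple (bool * bool) :=
  [tuple (has_pred P i, has_succ P i) | i < n].

(** * From Motzkin words to non-crossing partitions *)

Section Word.
Variables (n : nat) (w : n.-tuple (bool * bool)).
Implicit Types i j k m : 'I_n.

Local Notation h := (height w).

(** For the word of a non-crossing partition, this is one plus the number of arcs passing over
    [i]. *)
Definition level i : nat := h i + ~~ (tnth w i).1.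

(** The height test begins after the earlier step, because an opener of level [l] starts at height
    [l - 1]. *)
Definition linked i j : bool :=
  (level i == level j) &&
  [forall m : 'I_n, (minn i j < m <= maxn i j) ==> (level i <= h m)].

Definition word_partition : {set {set 'I_n}} :=
  equivalence_partition linked [set: 'I_n].

Lemma linkedP i j :
  reflect (level i = level j /\
           forall m, minn i j < m <= maxn i j -> level i <= h m) (linked i j).
Proof.
apply: (iffP andP) => -[/eqP Hl H]; split=> //.
  by move=> m mij; have /implyP/(_ mij) := forallP H m.
by apply/forallP => m; apply/implyP/H.
Qed.

Lemma linked_refl i : linked i i.
Proof. by apply/linkedP; split=> // m; lia. Qed.

Lemma linked_sym i j : linked i j = linked j i.
Proof.
by apply/linkedP/linkedP => -[E H]; split=> // m mij; rewrite -E H; lia.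
Qed.

Lemma linked_trans i j k : linked i j -> linked j k -> linked i k.
Proof.
move=> /linkedP[E H] /linkedP[E' H']; apply/linkedP; split; first by rewrite E.
move=> m mik; case: (boolP (minn i j < m <= maxn i j)) => [/H//|mij].
by rewrite E H'; lia.
Qed.

Lemma linked_eqv : {in [set: 'I_n] & &, equivalence_rel linked}.
Proof.
move=> i j k _ _ _; split=> [|ij]; first exact: linked_refl.
by apply/idP/idP; apply: linked_trans; rewrite // linked_sym.
Qed.

Lemma word_partitionP : partition word_partition [set: 'I_n].
Proof. exact/equivalence_partitionP/linked_eqv. Qed.

Lemma mem_word_block i j : (j \in pblock word_partition i) = linked i j.
Proof. by rewrite pblock_equivalence_partition ?inE //; exact: linked_eqv. Qed.

(** Reads the level from the height after the step instead of before it; the second alternative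
    absorbs the truncation in [step]. *)
Lemma levelE i : level i = h i.+1 + ~~ (tnth w i).2 \/ h i = 0 /\ (tnth w i).1.
Proof.
by rewrite heightS /level /step; case: (tnth w i) => -[] [] /=; lia.
Qed.

(** For crossing arcs from [a] to [b] and from [c] to [d], the chain [level a <= h c <= level c <= h
    b <= level b = level a] forces equal levels. Then [c] is linked to [a] and lies strictly between
    [a] and [b]. *)
Lemma noncrossing_word_partition : noncrossing word_partition.
Proof.
rewrite /noncrossing word_partitionP /=.
apply/'forall_'forall_'forall_'forall_negP => a b c d.
case/and5P=> ac cb bd ab cd.
have Lab : linked a b by rewrite -mem_word_block precedes_block.
have Lcd : linked c d by rewrite -mem_word_block precedes_block.
have [Eab Hab] := linkedP _ _ Lab.
have [Ecd Hcd] := linkedP _ _ Lcd.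
have c_ge : level a <= h c by apply: Hab; lia.
have b_ge : level c <= h b by apply: Hcd; lia.
have Eac : level a = level c by move: c_ge b_ge; rewrite Eab /level; lia.
apply: (precedes_between ab (c := c)); last by rewrite ac.
rewrite mem_word_block; apply/linkedP; split=> // m mac.
by apply: Hab; lia.
Qed.

Lemma linked_before i j : linked i j -> j < i -> (tnth w i).1.
Proof.
move=> /linkedP[_ H] ji; have := H i; rewrite /level; case: (tnth w i).1 => //=.
by move=> /(_ _); lia.
Qed.

Hypothesis w_bal : balanced w.

Lemma balanced_height i : (tnth w i).1 -> 0 < h i.
Proof. by have /andP[_ /forallP/(_ i)/implyP] := w_bal. Qed.

Lemma level_next i : level i = h i.+1 + ~~ (tnth w i).2.
Proof. by case: (levelE i) => // -[h0 /balanced_height]; rewrite h0. Qed.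

Lemma linked_after i j : linked i j -> i < j -> (tnth w i).2.
Proof.
move=> /linkedP[_ H] ij.
have lt : i.+1 < n by have := ltn_ord j; lia.
have := H (Ordinal lt) _; rewrite level_next /=; case: (tnth w i).2 => //=.
by move=> /(_ _); lia.
Qed.

(* The arc at [i] ends at, or continues through, the last position up to which
   the height stays at least [level i]. *)
Lemma exists_linked_after i : (tnth w i).2 -> exists2 j : 'I_n, i < j & linked i j.
Proof.
move=> wi; have := level_next i; rewrite wi addn0 => Ei.
pose Q (j : 'I_n) := (i < j) && [forall m : 'I_n, (i < m <= j) ==> (level i <= h m)].
have lev_gt0 : 0 < level i.
  by rewrite /level; case: (boolP (tnth w i).1) => [/balanced_height|]; lia.
have hn : h n = 0 by have /andP[/eqP] := w_bal.
have lt : i.+1 < n.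
  by rewrite ltn_neqAle ltn_ord andbT; apply/eqP => E; move: lev_gt0; rewrite Ei E hn.
have Q1 : Q (Ordinal lt).
  rewrite /Q /= leqnn; apply/forallP => m; apply/implyP => mi.
  by rewrite Ei (_ : i.+1 = m :> nat) //; lia.
have [j /andP[ij /forallP Hj] jmax] := @arg_maxnP _ (Ordinal lt) Q val Q1.
have hj : level i <= h j by have /implyP := Hj j; apply; lia.
exists j => //; apply/linkedP; split; last first.
  by move=> m mij; have /implyP := Hj m; apply; lia.
have hj1 : h j.+1 < level i.
  rewrite ltnNge; apply/negP => ge.
  have lt' : j.+1 < n.
    rewrite ltn_neqAle ltn_ord andbT; apply/eqP => E.
    by move: ge; rewrite E hn; lia.
  suff q : Q (Ordinal lt') by have := jmax _ q; rewrite /= ltnn.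
  rewrite /Q /= ltnS ltnW //; apply/forallP => m; apply/implyP => mi.
  case: (eqVneq (m : nat) j.+1) => [->//|mj].
  by have /implyP := Hj m; apply; lia.
(* The height falls below [level i] across [j], so [j] is a down step and its level is
   [h j = level i]. *)
move: hj1; rewrite heightS /step /level.
move: hj; rewrite /level; case: (tnth w j) => -[] [] /=; lia.
Qed.

(** Mirror image of [exists_linked_after]: take the first position after which the height stays at
    least [level i] up to [i]. It is an up step, since the path starts at height 0. *)
Lemma exists_linked_before i : (tnth w i).1 -> exists2 j : 'I_n, j < i & linked i j.
Proof.
move=> wi; have hi := balanced_height wi.
have Ei : level i = h i by rewrite /level wi addn0.
pose Q (j : 'I_n) := (j < i) && [forall m : 'I_n, (j < m <= i) ==> (level i <= h m)].
have h0 : h 0 = 0 by rewrite /height take0.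
have i0 : 0 < i by rewrite lt0n; apply/eqP => E; move: hi; rewrite E h0.
have lt : i.-1 < n by have := ltn_ord i; lia.
have Q1 : Q (Ordinal lt).
  rewrite /Q /= prednK // leqnn; apply/forallP => m; apply/implyP => mi.
  by rewrite Ei (_ : i = m :> nat) //; lia.
have [j /andP[ij /forallP Hj] jmin] := @arg_minnP _ (Ordinal lt) Q val Q1.
have lt1 : j.+1 < n by have := ltn_ord i; lia.
have hj1 : level i <= h j.+1.
  by have /implyP := Hj (Ordinal lt1); apply => /=; lia.
exists j => //; apply/linkedP; split; last first.
  by move=> m mij; have /implyP := Hj m; apply; lia.
have hj : h j < level i.
  rewrite ltnNge; apply/negP => ge.
  have j0 : 0 < j by rewrite lt0n; apply/eqP => E; move: ge; rewrite E h0; lia.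
  have lt' : j.-1 < n by have := ltn_ord j; lia.
  suff q : Q (Ordinal lt') by have := jmin _ q; rewrite /= -ltnS prednK // ltnn.
  rewrite /Q /=; apply/andP; split; first by lia.
  apply/forallP => m; apply/implyP => mi.
  case: (eqVneq m j) => [->//|/eqP mj].
  have {}mj : m <> j :> nat by move=> /val_inj.
  by have /implyP := Hj m; apply; lia.
move: hj1 hj; rewrite heightS /step Ei /level.
case: (tnth w j) => -[] [] /=; lia.
Qed.

Lemma word_partitionK : word_of word_partition = w.
Proof.
apply: eq_from_tnth => i; rewrite tnth_mktuple [RHS]surjective_pairing.
rewrite has_predE ?has_succE; try exact: word_partitionP.
congr pair; apply/exists_inP/idP => [[j]|].
- by rewrite mem_word_block; exact: linked_before.
- by case/exists_linked_before => j ji ij; exists j; rewrite ?mem_word_block.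
- by rewrite mem_word_block; exact: linked_after.
- by case/exists_linked_after => j ji ij; exists j; rewrite ?mem_word_block.
Qed.

End Word.

(** * From non-crossing partitions to words and back *)

Section Noncrossing.
Variables (n : nat) (P : {set {set 'I_n}}).
Hypothesis ncP : noncrossing P.
Let partP : partition P [set: 'I_n].
Proof. by case/andP: ncP. Qed.
Implicit Types i j a b : 'I_n.

Local Notation h := (height (word_of P)).

Lemma height_word_of m : m <= n -> h m = #|arcs P m|.
Proof.
elim: m => [|m IH] lt; first by rewrite arcs0 cards0 /height take0.
have := heightS (word_of P) (Ordinal lt); rewrite /= IH 1?ltnW // => ->.
rewrite tnth_mktuple /step /=; have := card_arcsS partP (Ordinal lt).
by rewrite /=; lia.
Qed.

Lemma height_word_of_ord i : h i = #|arcs P i|.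
Proof. by rewrite height_word_of // ltnW. Qed.

Lemma balanced_word_of : balanced (word_of P).
Proof.
rewrite /balanced height_word_of // arcs_top cards0 eqxx /=.
apply/forallP => i; apply/implyP; rewrite tnth_mktuple height_word_of_ord.
exact: has_pred_arcs.
Qed.

(** The common level is the number of arcs open at [b]: [arcs_pred] gives this at [a], and
    [arcs_sub] shows that these arcs stay open at every step in between. *)
Lemma precedes_linked a b : precedes P a b -> linked (word_of P) a b.
Proof.
move=> ab; have lt := precedes_lt ab.
have Ea : level (word_of P) a = #|arcs P b|.
  rewrite level_next ?balanced_word_of // tnth_mktuple /=.
  rewrite (_ : has_succ P a) ?addn0; last by apply/existsP; exists b.
  by rewrite height_word_of ?(arcs_pred partP ncP ab).
apply/linkedP; rewrite Ea; split=> [|m mab].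
  rewrite /level tnth_mktuple /= (_ : has_pred P b); last by apply/existsP; exists a.
  by rewrite addn0 height_word_of_ord.
by rewrite height_word_of_ord subset_leq_card // (arcs_sub partP ncP ab); lia.
Qed.

(** Strong induction on the larger element [j], replacing it by its predecessor. *)
Lemma linked_word_of i j : linked (word_of P) i j = (j \in pblock P i).
Proof.
wlog le_ij : i j / i <= j => [W|].
  have [/W//|/ltnW/W] := leqP i j.
  by rewrite linked_sym block_sym.
have [N] := ubnP j; elim: N i j le_ij => // N IH i j le_ij jN.
move: le_ij; rewrite leq_eqVlt => /orP[/eqP/val_inj <-|lt_ij].
  by rewrite linked_refl mem_block.
have step_pred a : precedes P a j -> i <= a ->
    linked (word_of P) i j = (j \in pblock P i).
  move=> aj ia; have lt_aj := precedes_lt aj.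
  have Laj := precedes_linked aj; have Baj := precedes_block aj.
  transitivity (linked (word_of P) i a).
    apply/idP/idP => H; apply: linked_trans H _ => //.
    by rewrite linked_sym.
  rewrite IH //; last by apply: leq_trans lt_aj _.
  apply/idP/idP => H; apply: (block_trans partP H) => //.
  by rewrite block_sym.
apply/idP/idP => H; last first.
  have [a aj ia] : exists2 a, precedes P a j & i <= a.
    by apply: exists_pred => //; rewrite block_sym.
  by rewrite (step_pred a).
have /existsP[a aj] : has_pred P j.
  have := @linked_before _ (word_of P) j i; rewrite tnth_mktuple linked_sym.
  exact.
have [ia|ai] := leqP i a; first by rewrite -(step_pred a).
(* When the predecessor [a] of [j] lies before [i], linkedness makes [arcs P j] and [arcs P i.+1]
   equinumerous, hence equal by [arcs_sub]. Then [i] starts an arc open at [j], against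
   [arcs_le]. *)
have si : has_succ P i.
  by have := linked_after balanced_word_of H lt_ij; rewrite tnth_mktuple.
have [Eij _] := linkedP _ _ _ H.
move: Eij; rewrite level_next ?balanced_word_of // /level !tnth_mktuple /= si.
rewrite (_ : has_pred P j); last by apply/existsP; exists a.
rewrite !addn0 height_word_of // height_word_of_ord => E.
have lt_aj := precedes_lt aj.
have sub : arcs P j \subset arcs P i.+1 by apply: arcs_sub aj _ => //; lia.
have Eq : arcs P j = arcs P i.+1 by apply/eqP; rewrite eqEcard sub E leqnn.
have : i \in arcs P j by rewrite Eq has_succ_arcs.
by move/(arcs_le partP ncP aj); lia.
Qed.

Lemma word_ofK : word_partition (word_of P) = P.
Proof.
rewrite -[RHS](equivalence_partition_pblock partP).
apply: eq_imset => i; apply/setP => j; rewrite !inE.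
exact: linked_word_of.
Qed.

End Noncrossing.

Lemma sum_noncrossing (V : nmodType) n (F : n.-tuple (bool * bool) -> V) :
  (\sum_(P in NC n) F (word_of P) = \sum_(w | balanced w) F w)%R.
Proof.
rewrite [RHS](reindex_onto (@word_of n) (@word_partition n)) /=; last first.
  by move=> w; exact: word_partitionK.
apply: eq_bigl => P; rewrite inE; apply/idP/andP => [ncP|[wP /eqP <-]].
  by rewrite balanced_word_of // word_ofK.
exact: noncrossing_word_partition.
Qed.

(** * Path weights and the continued fraction *)

Section Weights.
Local Open Scope ring_scope.
Variables (R : comNzRingType) (c t : nat -> R).

Fixpoint path_weight (h : nat) (w : seq (bool * bool)) : R :=
  if w is l :: w' then
    c h.+1 * t h ^+ l.1 * path_weight (step h l) w'
  else (h == 0)%N%:R.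

Fixpoint motzkin (h n : nat) : R :=
  if n is n'.+1 then
    c h.+1 * ((1 + t h) * motzkin h n' + motzkin h.+1 n' + t h * motzkin h.-1 n')
  else (h == 0)%N%:R.

Lemma path_weightE h n (w : n.-tuple (bool * bool)) :
  path_weight h w =
  \prod_(i < n) (c (foldl step h (take i w)).+1 *
                 t (foldl step h (take i w)) ^+ (tnth w i).1) *
  (foldl step h w == 0)%N%:R.
Proof.
elim: n h w => [|n IH] h w; first by rewrite tuple0 big_ord0 mul1r.
case/tupleP: w => l w; rewrite big_ord_recl /= IH tnth0 !mulrA.
congr (_ * _ * _); apply: eq_bigr => i _; rewrite /= tnthS //.
Qed.

(** A path ending at height 0 that is not balanced has a letter with predecessor bit at height 0,
    whose factor [t 0] vanishes. Hence the sum may run over all words. *)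
Lemma path_weight0E n (w : n.-tuple (bool * bool)) : t 0%N = 0 ->
  path_weight 0 w =
  if balanced w then
    \prod_(i < n) (c (height w i).+1 * t (height w i) ^+ (tnth w i).1)
  else 0.
Proof.
move=> t0; rewrite path_weightE /balanced /height [take n w]take_oversize ?size_tuple //.
case: eqP => _ /=; last by rewrite mulr0.
rewrite mulr1; case: forallP => // /forallP; rewrite negb_forall => /existsP[i].
rewrite negb_imply -leqNgt leqn0 => /andP[wi /eqP hi].
by rewrite (bigD1 i) //= hi wi t0 expr1 mulr0 mul0r.
Qed.

Lemma sum_path_weight h n :
  \sum_(w : n.-tuple (bool * bool)) path_weight h w = motzkin h n.
Proof.
elim: n h => [|n IH] h.
  rewrite (big_pred1 [tuple]) //= => w; apply/esym/eqP; exact: tuple0.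
pose f (p : (bool * bool) * n.-tuple (bool * bool)) := [tuple of p.1 :: p.2].
rewrite (reindex f) /=; last first.
  exists (fun w => (thead w, [tuple of behead w])) => [[l w] _|w _] /=.
    by congr pair; apply/val_inj.
  by rewrite /f /= -tuple_eta.
rewrite -(pair_bigA _ (fun l w => path_weight h (f (l, w)))) /=.
under eq_bigr do rewrite -mulr_sumr IH.
rewrite -(pair_bigA _ (fun a b : bool => c h.+1 * t h ^+ a * motzkin (step h (a, b)) n)) /=.
rewrite !big_bool /= /step /= !(addn0, addn1, subn0, subn1) /=.
by rewrite expr0 expr1; ring.
Qed.

Lemma sum_noncrossing_weight n : t 0%N = 0 ->
  \sum_(P in NC n) \prod_(i < n) (c #|arcs P i|.+1 * t #|arcs P i| ^+ has_pred P i)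
    = motzkin 0 n.
Proof.
move=> t0; rewrite -sum_path_weight.
under [RHS]eq_bigr do rewrite path_weight0E //.
rewrite -big_mkcond -sum_noncrossing; apply: eq_bigr => P; rewrite inE => ncP.
by apply: eq_bigr => i _; rewrite height_word_of_ord // tnth_mktuple.
Qed.

End Weights.

(** * Convolution of formal power series *)

Section PowerSeries.
Local Open Scope ring_scope.
Variable R : realType.
Implicit Types f g k : nat -> R.

Definition fps_shift f (n : nat) : R := if n is n'.+1 then f n' else 0.

(** Truncation to polynomials, from which commutativity and associativity of [fps_mul] are
    inherited. *)
Lemma fps_mul_poly N f g n : (n < N)%N ->
  fps_mul f g n = ((\poly_(i < N) f i) * (\poly_(i < N) g i))`_n.
Proof.
move=> nN; rewrite coefM; apply: eq_bigr => i _; rewrite !coef_poly.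
by rewrite !ifT //; have := ltn_ord i; lia.
Qed.

Lemma eq_fps_mul f f' g g' n :
  (forall i, (i <= n)%N -> f i = f' i) -> (forall i, (i <= n)%N -> g i = g' i) ->
  fps_mul f g n = fps_mul f' g' n.
Proof.
move=> Ef Eg; apply: eq_bigr => i _.
by rewrite Ef ?Eg ?leq_subr // -ltnS.
Qed.

Lemma fps_mulC f g : fps_mul f g =1 fps_mul g f.
Proof. by move=> n; rewrite !(@fps_mul_poly n.+1) // mulrC. Qed.

Lemma fps_mulA f g k : fps_mul f (fps_mul g k) =1 fps_mul (fps_mul f g) k.
Proof.
move=> n; pose p f := \poly_(i < n.+1) f i.
have E f1 g1 i : (i <= n)%N -> fps_mul f1 g1 i = (p f1 * p g1)`_i.
  by move=> ?; rewrite (@fps_mul_poly n.+1).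
have L f1 (q : {poly R}) : fps_mul f1 (fun i => q`_i) n = (p f1 * q)`_n.
  rewrite coefM; apply: eq_bigr => i _; rewrite coef_poly ifT //.
rewrite (@eq_fps_mul _ f _ (fun i => (p g * p k)`_i)) //; last by move=> i /E.
rewrite L [RHS]fps_mulC.
rewrite (@eq_fps_mul _ k _ (fun i => (p f * p g)`_i)) //; last by move=> i /E.
by rewrite L mulrA [p k * _]mulrC.
Qed.

Lemma fps_mul_shift f g : fps_mul (fps_shift f) g =1 fps_shift (fps_mul f g).
Proof.
case=> [|n]; first by rewrite /fps_mul big_ord1 mul0r.
by rewrite {1}/fps_mul big_ord_recl mul0r add0r.
Qed.

Lemma fps_mulSr f g n :
  fps_mul f g n.+1 = f n.+1 * g 0%N + fps_mul f (fun i => g i.+1) n.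
Proof.
rewrite /fps_mul big_ord_recr /= subnn addrC; congr (_ + _).
by apply: eq_bigr => i _; rewrite subSn // -ltnS.
Qed.

(** The equation [f = 1 + u z f + v z^2 f g]; the shift merges the cases of degree 1 and of higher
    degree. *)
Lemma jfrac_rec u v f g : fps_mul f (jden u v g) =1 fps_one R ->
  f 0%N = 1 /\ forall n, f n.+1 = u * f n + v * fps_shift (fps_mul f g) n.
Proof.
case/fps_mul_jdenE => f0 f1 f2; split=> // -[|n]; last exact: f2.
by rewrite f0 f1 /= mulr0 addr0 mulr1.
Qed.

End PowerSeries.

(** * First-passage decomposition of paths ending at height 0 *)

Section FirstPassage.
Local Open Scope ring_scope.
Variables (R : realType) (x y c t : nat -> R) (F : nat -> nat -> R).
Hypothesis t0 : t 0%N = 0.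
Hypothesis hx : forall k, (1 <= k)%N -> x k = c k * (1 + t k.-1).
Hypothesis hy : forall k, (1 <= k)%N -> y k = c k * c k.+1 * t k.
Hypothesis hF : forall k, (1 <= k)%N ->
  fps_mul (F k) (jden (x k) (y k) (F k.+1)) =1 fps_one R.

(** Generating series of weighted paths from height [h] to 0, cut at the first descent below [h]: an
    excursion counted by [F h.+1], a down step of weight [c h.+1 * t h], then a path from
    [h - 1]. *)
Fixpoint passage (h : nat) : nat -> R :=
  if h is h'.+1 then
    fps_shift (fun n => c h.+1 * t h * fps_mul (passage h') (F h.+1) n)
  else F 1.

Lemma fps_mulZl (b : R) f g n : fps_mul (fun i => b * f i) g n = b * fps_mul f g n.
Proof. by rewrite /fps_mul mulr_sumr; apply: eq_bigr => i _; rewrite mulrA. Qed.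

(** The recursion of [motzkin], obtained by expanding the factor [F h.+1] through its continued
    fraction equation: the constant term gives the descent, [x] the horizontal steps, and [y] the
    ascent. For [h = 0] the descent term dies with [t 0]. *)
Lemma passageS h n : passage h n.+1 =
  c h.+1 * ((1 + t h) * passage h n + passage h.+1 n + t h * passage h.-1 n).
Proof.
have [F0 FS] := jfrac_rec (hF (ltn0Sn h)).
have [->|h_gt0] := posnP h.
  have [_ {}FS] := jfrac_rec (hF (ltn0Sn 0)).
  rewrite /= FS hx // hy // t0; case: n => [|n] /=; ring.
case: h h_gt0 F0 FS => // h _ F0 FS; rewrite succnK.
(* The equation of [F h.+2] multiplied by an arbitrary series [f]. *)
have mulF f m : fps_mul f (F h.+2) m.+1 = f m.+1 + x h.+2 * fps_mul f (F h.+2) m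
    + y h.+2 * fps_shift (fps_mul (fps_mul f (F h.+2)) (F h.+3)) m.
  rewrite fps_mulSr F0 mulr1 -addrA; congr (_ + _).
  transitivity (x h.+2 * fps_mul f (F h.+2) m +
    y h.+2 * fps_mul f (fps_shift (fps_mul (F h.+2) (F h.+3))) m).
    rewrite /fps_mul !mulr_sumr -big_split; apply: eq_bigr => i _ /=.
    by rewrite FS /fps_mul; ring.
  congr (_ + _ * _); rewrite fps_mulC fps_mul_shift.
  by case: m => //= m; rewrite fps_mulC fps_mulA.
case: n => [|n] /=.
  by rewrite /fps_mul big_ord1 subnn F0; ring.
rewrite mulF.
have -> : fps_mul (passage h.+1) (F h.+3) n = c h.+2 * t h.+1 *
    fps_shift (fps_mul (fps_mul (passage h) (F h.+2)) (F h.+3)) n.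
  rewrite fps_mul_shift; case: n => [|n] /=; first by rewrite mulr0.
  exact: fps_mulZl.
rewrite hx // hy //=; ring.
Qed.

Lemma motzkin_passage h n : motzkin c t h n = passage h n.
Proof.
elim: n h => [|n IH] h; last by rewrite passageS /= !IH.
by case: h => [|h] //=; have [-> _] := jfrac_rec (hF (ltn0Sn 0)).
Qed.

End FirstPassage.

Lemma moments_motzkin (R : realType) (x y c t a : nat -> R) n :
  t 0 = 0%R ->
  (forall k, (1 <= k)%N -> x k = c k * (1 + t k.-1))%R ->
  (forall k, (1 <= k)%N -> y k = c k * c k.+1 * t k)%R ->
  moments x y a -> a n = motzkin c t 0 n.
Proof.
move=> t0 hx hy [F [<- hF]].
by rewrite (motzkin_passage t0 hx hy hF).
Qed.

(** * The statistics ell, gnum and zcomp *)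

Lemma prod_fibers (R : comNzRingType) (I : finType) (Q : pred I) (f : I -> nat)
    (F : nat -> R) (N : nat) :
  (forall i, Q i -> f i < N) ->
  (\prod_(i | Q i) F (f i) =
   \prod_(k < N) F k ^+ #|[set i | Q i && (f i == k)]|)%R.
Proof.
case: N => [|N] fN.
  by rewrite big_ord0 big_pred0 // => i; apply/negP => /fN.
rewrite (partition_big (fun i => inord (f i) : 'I_N.+1) predT) //=.
apply: eq_bigr => k _; rewrite -prodr_const; apply: eq_big => [i|i /andP[Qi /eqP <-]].
  rewrite inE; case: (boolP (Q i)) => // /fN fi.
  by rewrite -val_eqE /= inordK.
by rewrite inordK // fN.
Qed.

Lemma nth_map_iota (T : Type) (x0 : T) (f : nat -> T) m n i : i < n ->
  nth x0 [seq f j | j <- iota m n] i = f (m + i).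
Proof. by move=> lt; rewrite (nth_map 0) ?size_iota // nth_iota. Qed.

Section Statistics.
Variables (n : nat) (P : {set {set 'I_n}}).
Hypothesis ncP : noncrossing P.
Hypothesis n_gt0 : 0 < n.
Let partP : partition P [set: 'I_n].
Proof. by case/andP: ncP. Qed.
Implicit Types i : 'I_n.

Local Notation p := (ell_max P).

Lemma ellE k : ell P k = #|[set i : 'I_n | #|arcs P i| == k]|.
Proof. by apply: eq_card => i; rewrite !inE GamE. Qed.

Lemma gnumE k : gnum P k = #|[set i | has_pred P i && (#|arcs P i| == k)]|.
Proof.
apply: eq_card => i; rewrite !inE closer_transientE // gamE //.
by case: has_pred.
Qed.

Lemma gnum0 : gnum P 0 = 0.
Proof.
rewrite gnumE; apply/eqP; rewrite cards_eq0; apply/eqP/setP => i; rewrite !inE.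
by apply/negP => /andP[H /eqP E]; have := has_pred_arcs H; rewrite E.
Qed.

Lemma gnum_le_ell k : gnum P k <= ell P k.
Proof.
by rewrite gnumE ellE subset_leq_card //; apply/subsetP => i; rewrite !inE => /andP[].
Qed.

Lemma arcs_le_ell_max i : #|arcs P i| <= p.
Proof.
have lt : #|arcs P i| < n.+1 by rewrite ltnS -[leqRHS]card_ord max_card.
apply: (leq_bigmax_cond (Ordinal lt)) => /=.
by rewrite ellE card_gt0; apply/set0Pn; exists i; rewrite inE.
Qed.

Lemma ell0_gt0 : 0 < ell P 0.
Proof.
rewrite ellE card_gt0; apply/set0Pn; exists (Ordinal n_gt0).
by rewrite inE arcs0 cards0.
Qed.

Lemma exists_ell_max : exists i : 'I_n, #|arcs P i| = p.
Proof.
have : 0 < ell P p.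
  rewrite /ell_max (@bigop.bigmax_eq_arg _ ord0) ?ell0_gt0 //.
  by case: arg_maxnP => //; exact: ell0_gt0.
by rewrite ellE card_gt0 => /set0Pn[i]; rewrite inE => /eqP; exists i.
Qed.

(** The step just before the height first exceeds [k] goes up from [k]. *)
Lemma exists_up k : k < p -> exists2 i : 'I_n, #|arcs P i| = k & ~~ has_pred P i.
Proof.
move=> kp; have [i0 Ei0] := exists_ell_max.
have ex : exists m, (m <= n) && (k < #|arcs P m|).
  by exists i0; rewrite Ei0 kp ltnW.
case: (ex_minnP ex) => -[|m]; first by rewrite arcs0 cards0 ltn0 andbF.
case/andP=> lt km mmin.
have le : #|arcs P m| <= k.
  by rewrite leqNgt; apply/negP => H; have := mmin m; rewrite H ltnW // ltnn => /(_ isT).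
have := card_arcsS partP (Ordinal lt); rewrite -[nat_of_ord _]/m => E.
have [Em hm] : #|arcs P m| = k /\ ~~ has_pred P (Ordinal lt).
  by move: E; case: has_pred; case: has_succ => E; split=> //; lia.
by exists (Ordinal lt).
Qed.

(** The step starting at the last boundary of height at least [k] goes down from [k]; it exists
    because the final height is 0. *)
Lemma exists_down k : 0 < k <= p -> exists2 i : 'I_n, #|arcs P i| = k & has_pred P i.
Proof.
move=> /andP[k0 kp]; have [i0 Ei0] := exists_ell_max.
have ex : exists m, (m <= n) && (k <= #|arcs P m|).
  by exists i0; rewrite Ei0 kp ltnW.
have ub m : (m <= n) && (k <= #|arcs P m|) -> m <= n by case/andP.
case: (ex_maxnP ex ub) => m /andP[le km] mmax.
have lt : m < n.
  rewrite ltn_neqAle le andbT; apply/eqP => E; move: km; rewrite E arcs_top cards0; lia.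
have ge : #|arcs P m.+1| < k.
  by rewrite ltnNge; apply/negP => H; have := mmax m.+1; rewrite H lt ltnn => /(_ isT).
have := card_arcsS partP (Ordinal lt); rewrite -[nat_of_ord _]/m => E.
have [Em hm] : #|arcs P m| = k /\ has_pred P (Ordinal lt).
  by move: E; case: has_pred; case: has_succ => E; split=> //; lia.
by exists (Ordinal lt).
Qed.

Lemma gnum_gt0 k : 0 < k <= p -> 0 < gnum P k.
Proof.
case/exists_down=> i ik hi; rewrite gnumE card_gt0; apply/set0Pn; exists i.
by rewrite inE hi ik eqxx.
Qed.

Lemma gnum_lt_ell k : k < p -> gnum P k < ell P k.
Proof.
case/exists_up=> i ik hi; rewrite gnumE ellE; apply/proper_card/properP.
split; first by apply/subsetP => j; rewrite !inE => /andP[].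
by exists i; rewrite !inE ik eqxx // (negbTE hi).
Qed.

Lemma sum_ell : \sum_(k < p.+1) ell P k = n.
Proof.
rewrite -[RHS]card_ord -sum1_card.
rewrite (partition_big (fun i : 'I_n => inord #|arcs P i| : 'I_p.+1) predT) //=.
apply: eq_bigr => k _; rewrite sum1dep_card ellE; apply: eq_card => i.
by rewrite !inE -val_eqE /= inordK // ltnS arcs_le_ell_max.
Qed.

(** Brings [p = 0] under the general formula: there [gnum P 0 = 0 < ell P 0 = n], leaving the single
    entry [n]. *)
Lemma zcompE : zcomp P = [seq zstat P j | j <- iota 1 (2 * p + (gnum P p < ell P p))].
Proof.
rewrite /zcomp; case: eqP => [p0|_]; last by case: ifP => _ //; rewrite addn0.
rewrite p0 gnum0 ell0_gt0 /=; congr [:: _].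
by rewrite /zstat eqxx -[LHS]sum_ell p0 big_ord1.
Qed.

Lemma zstat_even k : zstat P k.*2 = gnum P k.
Proof. by rewrite /zstat odd_double doubleK; case: eqP => //; lia. Qed.

Lemma zstat_odd k : zstat P k.*2.+1 = ell P k - gnum P k.
Proof.
rewrite /zstat oddS odd_double /= uphalf_double.
by case: k => [|k]; rewrite ?gnum0 ?subn0.
Qed.

Lemma sum_zstat q : \sum_(1 <= j < q.*2.+2) zstat P j = \sum_(k < q.+1) ell P k.
Proof.
elim: q => [|q IH]; first by rewrite big_nat1 big_ord1.
rewrite doubleS 2?[in LHS]big_nat_recr //= IH [in RHS]big_ord_recr /= -addnA.
by rewrite -doubleS zstat_even zstat_odd subnKC // gnum_le_ell.
Qed.

(** Even entries are positive by [gnum_gt0], odd ones by [gnum_lt_ell]; pairing [z_(2k)] with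
    [z_(2k+1)] gives [ell P k], and these sum to [n]. *)
Lemma zcomp_composition : is_composition n (zcomp P).
Proof.
rewrite /is_composition zcompE; apply/andP; split.
  apply/allP => z /mapP[j]; rewrite mem_iota => jm ->.
  rewrite -(odd_double_half j); case: (boolP (odd j)) => oj /=.
    rewrite add1n zstat_odd subn_gt0.
    have : j./2 <= p by lia.
    rewrite leq_eqVlt => /orP[/eqP E|]; last exact: gnum_lt_ell.
    by move: jm; rewrite E; case: (gnum P p < ell P p) => //=; lia.
  rewrite add0n zstat_even gnum_gt0 //; lia.
rewrite sumnE big_map -[X in _ == X]sum_ell -sum_zstat.
case: (boolP (gnum P p < ell P p)) => [_|]; first by rewrite addn1 mul2n /index_iota subn1.
rewrite -leqNgt addn0 mul2n [in X in _ == X]big_nat_recr //= zstat_odd.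
(* The omitted last odd entry equals [ell P p - gnum P p = 0]. *)
by rewrite -subn_eq0 => /eqP ->; rewrite addn0 /index_iota subn1.
Qed.

Lemma size_zcomp : size (zcomp P) = p.*2 + (gnum P p < ell P p).
Proof. by rewrite zcompE size_map size_iota mul2n. Qed.

Lemma part_zcomp j : 0 < j <= size (zcomp P) -> part (zcomp P) j = zstat P j.
Proof.
rewrite size_zcomp zcompE /part => jm.
by rewrite nth_map_iota; [congr zstat; lia | lia].
Qed.

Lemma part_zcomp_even k : 0 < k <= p -> part (zcomp P) k.*2 = gnum P k.
Proof. by move=> kp; rewrite part_zcomp ?zstat_even // size_zcomp; lia. Qed.

Lemma part_zcomp_odd k : k < p -> part (zcomp P) k.*2.+1 = ell P k - gnum P k.
Proof. by move=> kp; rewrite part_zcomp ?zstat_odd // size_zcomp; lia. Qed.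

Lemma size_zcomp_le1 : (size (zcomp P) <= 1) = (p == 0).
Proof.
rewrite size_zcomp; case: eqP => [->|]; last by lia.
by case: (_ < _).
Qed.

Lemma size_zcomp_half : (size (zcomp P))./2 = p.
Proof. by rewrite size_zcomp; case: (_ < _); lia. Qed.

Lemma zcomp_ell_max0 : p = 0 -> zcomp P = [:: ell P 0].
Proof. by move=> p0; rewrite zcompE p0 gnum0 ell0_gt0. Qed.

Lemma iota1_pred q : 0 < q -> iota 1 q = rcons (iota 1 q.-1) q.
Proof. by case: q => // q _; rewrite succnK -{1}(addn1 q) iotaD cats1 add1n. Qed.

(** Each part of A is [z_(2k) + z_(2k+1) = ell P k]. When the length is even the last part is
    [gnum P p], which then equals [ell P p]. *)
Lemma splitA_zcomp : splitA (zcomp P) = [seq ell P k | k <- iota 0 p.+1].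
Proof.
rewrite /splitA size_zcomp_le1 size_zcomp_half.
have [p0|p_neq0] := eqVneq p 0; first by rewrite zcomp_ell_max0 // p0.
have p_gt0 : 0 < p by rewrite lt0n.
rewrite /= iota1_pred // map_rcons -[2]/(1 + 1) iotaDl -map_comp.
congr (_ :: rcons _ _).
- by rewrite (@part_zcomp_odd 0) // gnum0 subn0.
- apply/eq_in_map => k; rewrite mem_iota => kp /=.
  have -> : 2 * (1 + k) - 2 = k.*2 by lia.
  have -> : 2 * (1 + k) - 1 = k.*2.+1 by lia.
  by rewrite part_zcomp_even ?part_zcomp_odd ?subnKC ?gnum_le_ell //; lia.
rewrite size_zcomp oddD odd_double oddb addFb mul2n addn1 part_zcomp_even ?p_gt0 ?leqnn //.
case: ifP => [lt|/negbT]; last first.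
  by rewrite -leqNgt => ge; apply/eqP; rewrite eqn_leq gnum_le_ell.
by rewrite part_zcomp ?zstat_odd ?subnKC ?gnum_le_ell // size_zcomp lt addn1 leqnn.
Qed.

(** The parts of B after the first are [1 + gnum P k] for [k < p], then [gnum P p]. Depletion
    discards the first part and removes the added ones. *)
Lemma dep_splitB_zcomp : dep (splitB (zcomp P)) = [seq gnum P k | k <- iota 1 p].
Proof.
rewrite /splitB size_zcomp_le1 size_zcomp_half.
have [p0|p_neq0] := eqVneq p 0; first by rewrite zcomp_ell_max0 // p0.
have p_gt0 : 0 < p by rewrite lt0n.
rewrite /dep /= size_rcons size_map size_iota prednK // ltnS leqNgt p_gt0 /=.
rewrite (iota1_pred p_gt0) map_rcons subSS subn1; congr rcons.
  apply/eq_in_map => k; rewrite mem_iota => kp.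
  rewrite /part /=; case: k kp => [|k] //= kp.
  rewrite nth_rcons size_map size_iota (_ : k < p.-1); last by lia.
  rewrite nth_map_iota; last by lia.
  rewrite add1n subn1 succnK -[nth _ _ _]/(part _ _).
  have -> : 2 * k.+2 - 2 = k.+1.*2 by lia.
  by rewrite part_zcomp_even //; lia.
rewrite {1}/part succnK -[X in nth _ _ X](prednK p_gt0) /=.
rewrite nth_rcons size_map size_iota ltnn eqxx.
by rewrite mul2n part_zcomp_even // p_gt0 leqnn.
Qed.

Local Open Scope ring_scope.
Variables (R : realType).

Lemma monom_splitA_zcomp (c : nat -> R) :
  monom c (splitA (zcomp P)) = \prod_(i < n) c #|arcs P i|.+1.
Proof.
rewrite splitA_zcomp /monom size_map size_iota.
rewrite (@prod_fibers _ _ _ (fun i : 'I_n => #|arcs P i|) (fun k => c k.+1) p.+1); last first.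
  by move=> i _; rewrite ltnS arcs_le_ell_max.
rewrite big_add1 succnK big_mkord; apply: eq_bigr => k _.
by rewrite /part succnK nth_map_iota // ellE.
Qed.

Lemma monom_dep_splitB_zcomp (t : nat -> R) :
  monom t (dep (splitB (zcomp P))) = \prod_(i | has_pred P i) t #|arcs P i|.
Proof.
rewrite dep_splitB_zcomp /monom size_map size_iota.
rewrite (@prod_fibers _ _ _ (fun i : 'I_n => #|arcs P i|) t p.+1); last first.
  by move=> i _; rewrite ltnS arcs_le_ell_max.
rewrite big_ord_recl -gnumE gnum0 expr0 mul1r big_add1 succnK big_mkord.
apply: eq_bigr => k _.
by rewrite /part succnK nth_map_iota // -gnumE.
Qed.

End Statistics.


(** * Assembly of the moment formula *)

Local Open Scope ring_scope.

(** Groups partitions by [zcomp]: [zcomp_composition] ensures that none is lost, [compositions_uniq]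
    that none is counted twice. *)
Lemma sum_compositions_Ncount (R : pzRingType) n (F : seq nat -> R) : (0 < n)%N ->
  \sum_(k <- compositions n) (Ncount n k)%:R * F k = \sum_(P in NC n) F (zcomp P).
Proof.
move=> n_gt0; transitivity
  (\sum_(k <- compositions n) \sum_(P in NC n | zcomp P == k) F (zcomp P)).
  apply: eq_bigr => k _; rewrite /Ncount -sum1_card natr_sum mulr_suml.
  by apply: eq_big => [P|P]; rewrite inE // => /andP[_ /eqP ->]; rewrite mul1r.
rewrite (exchange_big_dep (fun P => P \in NC n)) /=; last by move=> k P _ /andP[].
apply: eq_bigr => P NCP; have ncP : noncrossing P by rewrite inE in NCP.
rewrite big_mkcond (bigD1_seq (zcomp P)) ?compositions_uniq //=; last first.
  by rewrite mem_compositions zcomp_composition.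
rewrite NCP eqxx big1 ?addr0 // => k kz.
by rewrite [zcomp P == k]eq_sym (negbTE kz).
Qed.

Theorem corollary8p20 (R : realType) (x y c t : nat -> R)
  (hTP : totally_positive x y)
  (hc : forall k, (1 <= k)%N -> 0 < c k)
  (ht : forall k, (1 <= k)%N -> 0 < t k)
  (ht0 : t 0%N = 0)
  (hx : forall k, (1 <= k)%N -> x k = c k * (1 + t k.-1))
  (hy : forall k, (1 <= k)%N -> y k = c k * c k.+1 * t k)
  (a : nat -> R) (ha : moments x y a)
  (n : nat) (hn : (1 <= n)%N) :
  a n = \sum_(k <- compositions n)
          (Ncount n k)%:R * monom c (splitA k) * monom t (dep (splitB k)).
Proof.
(* Both sides become sums over [NC n], compared term by term. *)
rewrite (moments_motzkin n ht0 hx hy ha) -sum_noncrossing_weight //.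
under [RHS]eq_bigr do rewrite -mulrA.
rewrite (sum_compositions_Ncount (fun k => monom c (splitA k) * monom t (dep (splitB k)))) //.
apply: eq_bigr => P; rewrite inE => ncP.
rewrite monom_splitA_zcomp // monom_dep_splitB_zcomp // big_split /=.
congr (_ * _); rewrite [RHS]big_mkcond; apply: eq_bigr => i _.
by case: has_pred.
Qed.
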